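(* Every Turing-recognizable (i.e. recursively enumerable) language can be recognized by a one-way q-alternating finite automaton (q-1AFA).
   Context: **Superoperators.** A superoperator on a finite-dimensional quantum register is a finite family $\mathcal{E}=\{E_1,\dots,E_k\}$ of square matrices with rational entries with $\sum_{i=1}^k E_i^\dagger E_i=I$. **qATM.** A q-alternating Turing machine (qATM) is an alternating Turing machine (read-only two-way input tape, read/write work tape; states are existential, universal, accepting or rejecting) augmented with a quantum register of fixed dimension (independent of the input). A configuration is a pair $(c,|\psi\rangle)$, where $c$ is a classical configuration and $|\psi\rangle$ is the state of the register. Let $c_1,\dots,c_{k_c}$ be the successors of $c$ given by the classical transition function. If $c$ is existential, the successors of $(c,|\psi\rangle)$ are $(c_i,|\psi\rangle)$, $1\le i\le k_c$. If $c$ is universal, a superoperator $\mathcal{E}_c=\{E_{c,1},\dots,E_{c,k_c}\}$, determined by the classical state and the symbols under the heads, is applied: with $|\widetilde{\psi_i}\rangle=E_{c,i}|\psi\rangle$ and $p_i=\langle\widetilde{\psi_i}|\widetilde{\psi_i}\rangle$, the successors are $(c_i,|\widetilde{\psi_i}\rangle/\sqrt{p_i})$ for those $i$ with $p_i>0$ (branches with $p_i=0$ do not exist). The computation starts in the initial classical configuration and a fixed initial quantum state, and a path stops when it enters an accepting or rejecting configuration. An input is accepted iff the computation tree contains a finite accepting subtree for some nondeterministic strategy: i.e. a finite subtree containing the root, containing one successor of each of its existential nodes and all successors of each of its universal nodes, all of whose leaves are accepting. The machine recognizes the set of accepted inputs. **q-1AFA.** A q-1AFA is a qATM without work tape whose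 input head is one-way (it never moves left; it may stay put). The input is delimited by end symbols. *)

(* Defs.v *)
From HB Require Import structures.
From mathcomp Require Import all_boot all_order all_algebra all_field.

Set Implicit Arguments.
Unset Strict Implicit.
Unset Printing Implicit Defensive.

Import Order.TTheory GRing.Theory Num.Theory.
Local Open Scope ring_scope.

Inductive direction := MoveL | MoveN | MoveR.

(* Deterministic machine with one tape, infinite in both directions. *)
Record turing_machine (Sigma : finType) := TuringMachine {
  tm_state : finType;
  tm_symbol : finType;
  tm_blank : tm_symbol;
  tm_letter : Sigma -> tm_symbol;
  tm_letter_inj : injective tm_letter;
  tm_letter_blank : forall x, tm_letter x != tm_blank;
  tm_start : tm_state;
  tm_accept : tm_state;
  tm_reject : tm_state;
  tm_accept_reject : tm_accept != tm_reject;
  tm_trans : tm_state -> tm_symbol -> tm_state * tm_symbol * direction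
}.

Section TuringMachine.
Variables (Sigma : finType) (M : turing_machine Sigma).

(* (q, l, r): l lists the cells to the left of the head, nearest first, and r
   lists the cells from the scanned one on; all cells not listed are blank. *)
Definition tm_config : Type := tm_state M * seq (tm_symbol M) * seq (tm_symbol M).

Definition tm_init (w : seq Sigma) : tm_config :=
  (tm_start M, [::], map (@tm_letter _ M) w).

Definition tm_step (c : tm_config) : tm_config :=
  let: (q, l, r) := c in
  if (q == tm_accept M) || (q == tm_reject M) then c else
  let: (q', b, m) := tm_trans q (head (tm_blank M) r) in
  let r' := behead r in
  match m with
  | MoveL => (q', behead l, head (tm_blank M) l :: b :: r')
  | MoveN => (q', l, b :: r')
  | MoveR => (q', b :: l, r')
  end.

Definition tm_accepts (w : seq Sigma) : Prop :=
  exists n, (iter n tm_step (tm_init w)).1.1 = tm_accept M.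

End TuringMachine.

Definition turing_recognizable (Sigma : finType) (L : seq Sigma -> Prop) : Prop :=
  exists M : turing_machine Sigma, forall w, L w <-> tm_accepts M w.

(* The adjoint of a matrix with rational entries is its transpose. *)
Definition superoperator (d : nat) (I : finType) (A : {set I})
    (E : I -> 'M[rat]_d) : Prop :=
  \sum_(i in A) (E i)^T *m E i = 1%:M.

(* Amplitudes are algebraic numbers: the entries of the operators and of the
   initial state are rational, and renormalization takes square roots. *)
Definition qstate (d : nat) := 'cV[algC]_d.

Definition sqnorm (d : nat) (psi : qstate d) : algC :=
  ((map_mx Num.conj psi)^T *m psi) 0 0.

Definition apply_op (d : nat) (E : 'M[rat]_d) (psi : qstate d) : qstate d :=
  map_mx ratr E *m psi.

Definition normalize (d : nat) (psi : qstate d) : qstate d :=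
  (sqrtC (sqnorm psi))^-1 *: psi.

Inductive state_kind := Existential | Universal | Accepting | Rejecting.

Inductive tape_symbol (Sigma : Type) :=
  | LeftEnd | Letter of Sigma | RightEnd.
Arguments LeftEnd {Sigma}.
Arguments RightEnd {Sigma}.

(* In a transition (q', b), the boolean b tells whether the input head moves one
   cell to the right (true) or stays put (false).  With no work tape, distinct
   transitions lead to distinct classical successors, so the operators
   E_{c,1}, ..., E_{c,k_c} are indexed by the transitions themselves. *)
Record q1afa (Sigma : finType) := Q1AFA {
  qa_state : finType;
  qa_kind : qa_state -> state_kind;
  qa_start : qa_state;
  qa_trans : qa_state -> tape_symbol Sigma -> {set qa_state * bool};
  qa_trans_right_end : forall q t, t \in qa_trans q RightEnd -> t.2 = false;
  qa_dim : nat;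
  qa_op : qa_state -> tape_symbol Sigma -> qa_state * bool -> 'M[rat]_qa_dim;
  qa_op_superoperator : forall q a, qa_kind q = Universal ->
    superoperator (qa_trans q a) (qa_op q a);
  qa_qinit : 'cV[rat]_qa_dim;
  qa_qinit_unit : qa_qinit^T *m qa_qinit = 1%:M
}.

(* Nodes have finitely many children, so these trees are finite. *)
Inductive ctree (C : Type) := CNode of C & seq (ctree C).

Definition root_label (C : Type) (t : ctree C) : C :=
  let: CNode c _ := t in c.

Section Q1AFA.
Variables (Sigma : finType) (M : q1afa Sigma).

Definition qa_tape (w : seq Sigma) : seq (tape_symbol Sigma) :=
  LeftEnd :: rcons (map (@Letter Sigma) w) RightEnd.

(* The default value is never reached: the head cannot move past the right end
   symbol. *)
Definition qa_scanned (w : seq Sigma) (pos : nat) : tape_symbol Sigma :=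
  nth RightEnd (qa_tape w) pos.

(* classical state, position of the input head, state of the register *)
Definition qa_config : Type := qa_state M * nat * qstate (qa_dim M).

Definition qa_init : qa_config := (qa_start M, 0%N, map_mx ratr (qa_qinit M)).

Definition qa_successors (w : seq Sigma) (c : qa_config) : seq qa_config :=
  let: (q, pos, psi) := c in
  let a := qa_scanned w pos in
  match qa_kind q with
  | Existential =>
      [seq (t.1, (pos + t.2)%N, psi) | t : qa_state M * bool <- enum (qa_trans q a)]
  | Universal =>
      [seq (t.1, (pos + t.2)%N, normalize (apply_op (qa_op q a t) psi))
      | t : qa_state M * bool <- enum (qa_trans q a) & 0 < sqnorm (apply_op (qa_op q a t) psi)]
  | Accepting | Rejecting => [::]
  end.

(* t is a subtree of the computation tree rooted at its own root, with one
   successor of each existential node and all successors of each universal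
   node, all of whose leaves are accepting. *)
Fixpoint accepting_subtree (w : seq Sigma) (t : ctree qa_config) : bool :=
  let: CNode c ts := t in
  [&& match qa_kind c.1.1 with
      | Existential =>
          (size ts == 1)%N && all [in qa_successors w c] (map (@root_label _) ts)
      | Universal => map (@root_label _) ts == qa_successors w c
      | Accepting => nilp ts
      | Rejecting => false
      end
    & all (accepting_subtree w) ts].

Definition qa_accepts (w : seq Sigma) : Prop :=
  exists t : ctree qa_config, root_label t = qa_init /\ accepting_subtree w t.

End Q1AFA.

Definition q1afa_recognizes (Sigma : finType) (M : q1afa Sigma)
    (L : seq Sigma -> Prop) : Prop :=
  forall w, L w <-> qa_accepts M w.

(* Main.v *)
(* The register holds, up to a scalar, the vector (1, x, y), where x and y are
   the two half-tapes of the simulated Turing machine read as base-b numbers.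
   Any finite family of rational matrices A_i becomes a superoperator after a
   common rescaling, once completed by further operators leading to acceptance,
   which never affect the outcome.  At each step the existential player guesses
   the digits s and t to be popped, and the affine update is applied.  A pop is
   correct iff (x - t) / b and (y - s) / b are again numerals, which is tested in
   a parallel universal branch: there the existential player pops digits until
   reaching (0, 0), and a universal node whose only rejecting successor has the
   amplitudes of x and y verifies that both vanish, as the successor then does
   not exist. *)
Require Import Defs.
From HB Require Import structures.
From mathcomp Require Import all_boot all_order all_algebra all_field ring zify.

Set Implicit Arguments.
Unset Strict Implicit.
Unset Printing Implicit Defensive.

Import Order.TTheory GRing.Theory Num.Theory.
Local Open Scope ring_scope.

(** * Induction over accepting subtrees and rules for building them *)

Section AcceptingSubtrees.
Variables (Sigma : finType) (M : q1afa Sigma) (w : seq Sigma).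

(** [ctree] nests through [seq], so the induction is a hand-written fixpoint; [P] sees root labels
    only, so the trees can be forgotten afterwards. *)
Lemma accepting_subtree_ind (P : qa_config M -> Prop) :
    (forall c, qa_kind c.1.1 = Accepting -> P c) ->
    (forall c c', qa_kind c.1.1 = Existential -> c' \in qa_successors w c ->
       P c' -> P c) ->
    (forall c, qa_kind c.1.1 = Universal ->
       (forall c', c' \in qa_successors w c -> P c') -> P c) ->
  forall t, accepting_subtree w t -> P (root_label t).
Proof.
move=> Pacc Pex Puniv; fix IH 1; case=> c ts /= /andP[ok_c ok_ts].
have Pts c' : c' \in map (@root_label _) ts -> P c'.
  elim: ts ok_ts {ok_c} => //= t ts IHts /andP[/IH Pt /IHts{}IHts].
  by rewrite inE => /predU1P[->|].
case kind_c: (qa_kind _) ok_c.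
- case/andP; case: ts Pts {ok_ts} => [|t []] //= Pts _; rewrite andbT => t_succ.
  by apply: Pex t_succ _ => //; apply: Pts; rewrite mem_head.
- by move/eqP=> succ_c; apply: Puniv => // c'; rewrite -succ_c => /Pts.
- by move=> _; apply: Pacc.
- by [].
Qed.

Definition qa_wins (c : qa_config M) :=
  exists t, root_label t = c /\ accepting_subtree w t.

Lemma qa_wins_accepting c : qa_kind c.1.1 = Accepting -> qa_wins c.
Proof. by move=> kind_c; exists (CNode c [::]); rewrite /= kind_c. Qed.

Lemma qa_wins_existential c c' :
  qa_kind c.1.1 = Existential -> c' \in qa_successors w c -> qa_wins c' ->
  qa_wins c.
Proof.
move=> kind_c c'_succ [t [root_t ok_t]]; exists (CNode c [:: t]).
by rewrite /= kind_c /= root_t c'_succ ok_t.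
Qed.

Lemma qa_wins_universal c :
    qa_kind c.1.1 = Universal ->
    (forall c', c' \in qa_successors w c -> qa_wins c') ->
  qa_wins c.
Proof.
move=> kind_c succ_wins.
(* A subtree exists for each successor separately; induction on the successor list collects them
   without choice. *)
have [ts [root_ts ok_ts]] : exists ts,
    map (@root_label _) ts = qa_successors w c /\ all (accepting_subtree w) ts.
  elim: (qa_successors w c) succ_wins => [|c1 s IHs] wins_s; first by exists [::].
  have [t [<- ok_t]] := wins_s c1 (mem_head _ _).
  have [|ts [<- ok_ts]] := IHs.
    by move=> c' c'_s; apply: wins_s; rewrite inE c'_s orbT.
  by exists (t :: ts); rewrite /= ok_t.
by exists (CNode c ts); rewrite /= kind_c root_ts eqxx.
Qed.

End AcceptingSubtrees.

(** * Vanishing norms and rational completion to a superoperator *)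

Lemma sqnorm_gt0 d (psi : qstate d) : (0 < sqnorm psi) = (psi != 0).
Proof.
have normE : sqnorm psi = \sum_i `|psi i 0| ^+ 2.
  by rewrite /sqnorm mxE; apply: eq_bigr => i _; rewrite !mxE -normCKC.
have norm_ge0 i : true -> 0 <= `|psi i 0| ^+ 2 by move=> _; rewrite exprn_ge0.
rewrite lt0r normE sumr_ge0 // andbT psumr_eq0 //; congr (~~ _).
apply/allP/eqP => [psi0 | -> i _]; last by rewrite mxE normr0 expr0n /= eqxx.
apply/colP => i; apply/eqP.
by have := psi0 i (mem_index_enum _); rewrite mxE /= expf_eq0 normr_eq0.
Qed.

(** The matrix of the cross product with [a]: it complements the single row [a] to a scalar Gram
    matrix without leaving the rationals. *)
Definition cross_mx (a : 'rV[rat]_3) : 'M[rat]_3 :=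
  \matrix_(i, j) (nth [::]
    [:: [:: 0; - a 0 2%:R; a 0 1];
        [:: a 0 2%:R; 0; - a 0 0];
        [:: - a 0 1; a 0 0; 0]] i)`_j.

Lemma ord3P (P : 'I_3 -> Prop) : P 0 -> P 1 -> P 2%:R -> forall i, P i.
Proof.
move=> P0 P1 P2 [[|[|[|//]]] lt_i3].
- by rewrite (_ : Ordinal _ = 0) //; apply: val_inj.
- by rewrite (_ : Ordinal _ = 1) //; apply: val_inj.
- by rewrite (_ : Ordinal _ = 2%:R) //; apply: val_inj.
Qed.

Lemma sum_ord3 (V : nmodType) (F : 'I_3 -> V) :
  \sum_i F i = F 0 + F 1 + F 2%:R.
Proof.
rewrite !big_ord_recr big_ord0 /= Monoid.mul1m.
by congr (F _ + F _ + F _); apply: val_inj.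
Qed.

(* Lagrange's identity (a . x)^2 + |a x x|^2 = |a|^2 |x|^2. *)
Lemma cross_mxP (a : 'rV[rat]_3) :
  a^T *m a + (cross_mx a)^T *m cross_mx a = (\sum_i a 0 i ^+ 2)%:M.
Proof.
apply/matrixP; elim/ord3P; elim/ord3P;
  rewrite mxE [X in X + _]mxE big_ord1 [X in _ + X]mxE !sum_ord3 !mxE /=; ring.
Qed.

Lemma mulmx_tr_row m n (A : 'M[rat]_(m, n)) :
  A^T *m A = \sum_k (row k A)^T *m row k A.
Proof.
apply/matrixP => i j; rewrite mxE summxE; apply: eq_bigr => k _.
by rewrite !mxE big_ord1 !mxE.
Qed.

Section Kraus.
Variables (Q : finType) (A : Q -> 'M[rat]_3).

(** The scalar that the Gram matrices add up to once every row has its cross product companion. *)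
Definition weight : rat := \sum_q \sum_k \sum_i row k (A q) 0 i ^+ 2.

(* The identity 4 n + (n - 1)^2 = (n + 1)^2 with n = weight keeps the
   normalization rational. *)
Definition kraus (x : Q + (Q * 'I_3 + unit)) : 'M[rat]_3 :=
  (weight + 1)^-1 *:
    match x with
    | inl q => 2%:R *: A q
    | inr (inl p) => 2%:R *: cross_mx (row p.2 (A p.1))
    | inr (inr tt) => (weight - 1)%:M
    end.

Lemma weight1_gt0 : 0 < weight + 1.
Proof.
rewrite ltr_wpDl // !sumr_ge0 // => q _; rewrite sumr_ge0 // => k _.
by rewrite sumr_ge0 // => i _; rewrite sqr_ge0.
Qed.

Lemma kraus_sum : \sum_x (kraus x)^T *m kraus x = 1%:M.
Proof.
have gramZ (c : rat) (B : 'M[rat]_3) : (c *: B)^T *m (c *: B) = c ^+ 2 *: (B^T *m B).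
  by rewrite !linearZ /= -scalemxAl scalerA expr2.
under eq_bigr do rewrite gramZ.
rewrite -scaler_sumr !big_sumType /= (big_pred1 tt); last by case.
under eq_bigr do rewrite gramZ mulmx_tr_row.
under [X in _ + (X + _)]eq_bigr do rewrite gramZ.
(* Each row meets its cross product companion, so that Lagrange's identity makes every summand
   scalar. *)
rewrite -!scaler_sumr pair_bigA addrA -scalerDr -big_split /=.
under eq_bigr do rewrite cross_mxP.
rewrite -(pair_bigA _ (fun q k => (\sum_i row k (A q) 0 i ^+ 2)%:M)) /=.
under eq_bigr do rewrite -raddf_sum.
rewrite -raddf_sum -/weight tr_scalar_mx -scalar_mxM scale_scalar_mx.
rewrite -raddfD scale_scalar_mx /=; congr (_%:M).
by field; rewrite gt_eqF // weight1_gt0.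
Qed.

End Kraus.

(* An automaton whose operators are arbitrary rational matrices: its register
   is not normalized, and branches on which it vanishes do not exist. *)
Record program (Sigma : finType) := Program {
  pr_state : finType;
  pr_kind : pr_state -> state_kind;
  pr_start : pr_state;
  pr_succ : pr_state -> {set pr_state};
  pr_op : pr_state -> tape_symbol Sigma -> pr_state -> 'M[rat]_3;
  pr_move : pr_state -> tape_symbol Sigma -> bool;
  pr_move_right_end : forall p, pr_move p RightEnd = false;
  pr_init : 'cV[rat]_3;
  pr_init_unit : pr_init^T *m pr_init = 1%:M
}.

(** * Compiling a program into a q-1AFA *)

Section Program.
Variables (Sigma : finType) (P : program Sigma).
Implicit Types (p : pr_state P) (a : tape_symbol Sigma).

(** A universal node ranges over all states: a zero operator is how a transition is left out. *)
Inductive pr_wins (w : seq Sigma) : pr_state P -> nat -> 'cV[rat]_3 -> Prop :=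
  | PrAccepting p i v of pr_kind p = Accepting : pr_wins w p i v
  | PrExistential p i v p' of
      pr_kind p = Existential & p' \in pr_succ p
      & pr_wins w p' (i + pr_move p (qa_scanned w i)) v : pr_wins w p i v
  | PrUniversal p i v of
      pr_kind p = Universal
      & (forall p', pr_op p (qa_scanned w i) p' *m v != 0 ->
           pr_wins w p' (i + pr_move p (qa_scanned w i))
                   (pr_op p (qa_scanned w i) p' *m v)) : pr_wins w p i v.

(** A branch of [kraus] is named by its target state; the right summand holds the completing
    branches. *)
Let state : finType := (pr_state P + (pr_state P * 'I_3 + unit))%type.

Definition compiled_kind (x : state) :=
  if x is inl p then pr_kind p else Accepting.

Definition compiled_trans (x : state) a : {set state * bool} :=
  if x is inl p then
    [set y | (y.2 == pr_move p a) &&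
      if pr_kind p is Existential then
        if y.1 is inl p' then p' \in pr_succ p else false
      else true]
  else set0.

Definition compiled_op (x : state) a (y : state * bool) : 'M[rat]_3 :=
  if x is inl p then kraus (pr_op p a) y.1 else 0.

Lemma compiled_trans_right_end x y :
  y \in compiled_trans x RightEnd -> y.2 = false.
Proof.
by case: x => [p|] /=; rewrite inE // pr_move_right_end => /andP[/eqP].
Qed.

Lemma compiled_superoperator x a : compiled_kind x = Universal ->
  superoperator (compiled_trans x a) (compiled_op x a).
Proof.
case: x => [p|//] /= kind_p; rewrite /superoperator -(kraus_sum (pr_op p a)).
(* All transitions from [p] share one head move, so their targets index them. *)
rewrite (reindex_onto (fun x => (x, pr_move p a)) fst) /=.
  by apply: eq_bigl => x; rewrite inE /= kind_p !eqxx.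
by case=> x b; rewrite inE /= => /andP[/eqP->].
Qed.

Definition compiled : q1afa Sigma :=
  Q1AFA (inl (pr_start P)) compiled_trans_right_end compiled_superoperator
    (pr_init_unit P).

(** Rescaling and normalization only introduce nonzero scalars, so [v] is tracked up to a factor
    [c]. *)
Definition scaled_config p i (c : algC) (v : 'cV[rat]_3) : qa_config compiled :=
  (inl p, i, c *: map_mx ratr v).

Lemma normalize_neq0 d (psi : qstate d) : psi != 0 ->
  exists2 e : algC, e != 0 & normalize psi = e *: psi.
Proof.
rewrite -sqnorm_gt0 => psi_gt0; exists (sqrtC (sqnorm psi))^-1 => //.
by rewrite invr_eq0 sqrtC_eq0 gt_eqF.
Qed.

Lemma kraus_apply (A : pr_state P -> 'M[rat]_3) p (c : algC) (v : 'cV[rat]_3) :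
    c != 0 ->
  exists2 e : algC, e != 0 &
    apply_op (kraus A (inl p)) (c *: map_mx ratr v) = e *: map_mx ratr (A p *m v).
Proof.
move=> c_neq0; exists (ratr ((weight A + 1)^-1 * 2%:R) * c).
  by rewrite mulf_neq0 // fmorph_eq0 mulf_neq0 // invr_eq0 gt_eqF ?weight1_gt0.
by rewrite /apply_op /kraus scalerA map_mxZ -scalemxAl -scalemxAr -map_mxM scalerA.
Qed.

Lemma map_ratr_eq0 (v : 'cV[rat]_3) : (map_mx ratr v == 0 :> 'cV[algC]_3) = (v == 0).
Proof. by rewrite map_mx_eq0. Qed.

Lemma scaled_successor (w : seq Sigma) p i (c : algC) v p' :
    c != 0 -> pr_kind p = Universal -> pr_op p (qa_scanned w i) p' *m v != 0 ->
  exists2 d : algC, d != 0 &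
    scaled_config p' (i + pr_move p (qa_scanned w i)) d
                  (pr_op p (qa_scanned w i) p' *m v)
      \in qa_successors w (scaled_config p i c v).
Proof.
set a := qa_scanned w i => c_neq0 kind_p v'_neq0.
have [e e_neq0 applyE] := kraus_apply (pr_op p a) p' v c_neq0.
have psi_neq0 : e *: map_mx ratr (pr_op p a p' *m v) != 0 :> qstate 3.
  by rewrite scaler_eq0 negb_or e_neq0 map_ratr_eq0.
have [d d_neq0 normE] := normalize_neq0 psi_neq0.
exists (d * e); first by rewrite mulf_neq0.
rewrite /= kind_p -/a; apply/mapP; exists (inl p', pr_move p a) => /=.
  by rewrite mem_filter /= applyE sqnorm_gt0 psi_neq0 mem_enum inE /= eqxx.
by rewrite applyE normE scalerA.
Qed.

Lemma qa_wins_scaled (w : seq Sigma) p i v :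
  pr_wins w p i v -> forall c, c != 0 -> qa_wins w (scaled_config p i c v).
Proof.
elim=> {p i v} [p i v kind_p | p i v p' kind_p succ_p' _ IHp | p i v kind_p _ IHp]
  c c_neq0.
- exact: qa_wins_accepting.
- pose c' := scaled_config p' (i + pr_move p (qa_scanned w i)) c v.
  apply: (qa_wins_existential (c' := c')) => //.
    rewrite /= kind_p; apply/mapP; exists (inl p', pr_move p (qa_scanned w i)) => //.
    by rewrite mem_enum inE /= eqxx.
  exact: IHp.
- apply: qa_wins_universal => // c' /=; rewrite kind_p => /mapP[[x b]].
  rewrite mem_filter mem_enum inE /= => /andP[psi_gt0 /andP[/eqP-> _]] ->.
  (* Completing branches accept at once. *)
  case: x psi_gt0 => [p' | x] psi_gt0; last exact: qa_wins_accepting.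
  have [e e_neq0 applyE] := kraus_apply (pr_op p (qa_scanned w i)) p' v c_neq0.
  move: psi_gt0; rewrite applyE sqnorm_gt0 => psi_neq0.
  have [d d_neq0 ->] := normalize_neq0 psi_neq0.
  rewrite scalerA; apply: IHp; last by rewrite mulf_neq0.
  by apply: contraNneq psi_neq0 => ->; rewrite map_mx0 scaler0.
Qed.

Lemma pr_wins_scaled (w : seq Sigma) p i c v :
  c != 0 -> qa_wins w (scaled_config p i c v) -> pr_wins w p i v.
Proof.
move=> c_neq0 [t [root_t ok_t]].
(* A label determines [v] only up to a scalar, hence the quantification over all its
   representations. *)
pose W (x : qa_config compiled) := forall p i c v,
  c != 0 -> x = scaled_config p i c v -> pr_wins w p i v.
suff: W (root_label t) by apply; eauto.
apply: (accepting_subtree_ind (P := W)) ok_t => {root_t t p i c v c_neq0}.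
- by move=> x kind_x p i c v c_neq0 def_x; apply: PrAccepting; rewrite def_x in kind_x.
- move=> x y kind_x xy Wy p i c v c_neq0 def_x; rewrite def_x /= in kind_x xy.
  move: xy; rewrite kind_x => /mapP[[[p'|x'] b]]; rewrite mem_enum inE /=.
    case/andP=> /eqP-> succ_p' def_y.
    by apply: PrExistential succ_p' (Wy _ _ _ _ c_neq0 def_y).
  by rewrite andbF.
- move=> x kind_x Wsucc p i c v c_neq0 def_x; rewrite def_x /= in kind_x Wsucc.
  apply: PrUniversal => // p' v'_neq0.
  have [d d_neq0 succ_d] := scaled_successor c_neq0 kind_x v'_neq0.
  exact: Wsucc succ_d _ _ _ _ d_neq0 erefl.
Qed.

Lemma compiled_accepts (w : seq Sigma) :
  qa_accepts compiled w <-> pr_wins w (pr_start P) 0 (pr_init P).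
Proof.
have -> : qa_accepts compiled w =
    qa_wins w (scaled_config (pr_start P) 0 1 (pr_init P)).
  by rewrite /qa_accepts /qa_init /scaled_config scale1r.
split=> [|wins]; first exact: pr_wins_scaled (oner_neq0 _).
by apply: (qa_wins_scaled wins); apply: oner_neq0.
Qed.

End Program.

(** * Affine maps and the zero test in homogeneous coordinates *)

Definition vec3 (x y : rat) : 'cV[rat]_3 := \col_i [:: 1; x; y]`_i.

Definition affine_mx (a0 a1 a2 b0 b1 b2 : rat) : 'M[rat]_3 :=
  \matrix_(i, j)
    (nth [::] [:: [:: 1; 0; 0]; [:: a0; a1; a2]; [:: b0; b1; b2]] i)`_j.

Lemma affine_mxE a0 a1 a2 b0 b1 b2 x y :
  affine_mx a0 a1 a2 b0 b1 b2 *m vec3 x y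
  = vec3 (a0 + a1 * x + a2 * y) (b0 + b1 * x + b2 * y).
Proof.
by apply/colP; elim/ord3P; rewrite mxE sum_ord3 !mxE /=; ring.
Qed.

(** Affine maps keep the constant coordinate, so their branches always exist. *)
Lemma vec3_neq0 x y : vec3 x y != 0.
Proof. by apply/eqP => /colP/(_ 0); rewrite !mxE. Qed.

Definition constant_kernel_mx : 'M[rat]_3 := \matrix_(i, j) ((i == j) && (i != 0))%:R.

Lemma constant_kernel_mxP x y :
  (constant_kernel_mx *m vec3 x y == 0) = (x == 0) && (y == 0).
Proof.
apply/eqP/andP => [/colP v0 | [/eqP-> /eqP->]].
  have := (v0 1, v0 2%:R); rewrite !mxE !sum_ord3 !mxE /=.
  by rewrite !mul0r !mul1r !addr0 !add0r => -[-> ->].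
by apply/colP; elim/ord3P; rewrite mxE sum_ord3 !mxE /=; ring.
Qed.

(* Scan reads the input; Simulate (Some q) is a configuration of the simulated
   machine in state q, and Simulate None claims that both half-tapes are base-b
   numerals; Pop o s t removes the guessed digits t (left) and s (right). *)
Inductive phase (Q S : Type) :=
  Scan | Simulate of option Q | Pop of option Q & S & S | ZeroTest | Reject.
Arguments Scan {Q S}.
Arguments Simulate {Q S}.
Arguments ZeroTest {Q S}.
Arguments Reject {Q S}.

Section PhaseFinite.
Variables Q S : finType.

Definition phase_code (p : phase Q S) : option Q + (option Q * S * S + 'I_3) :=
  match p with
  | Simulate o => inl o
  | Pop o s t => inr (inl (o, s, t))
  | Scan => inr (inr 0)
  | ZeroTest => inr (inr 1)
  | Reject => inr (inr 2%:R)
  end.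

Definition phase_decode (x : option Q + (option Q * S * S + 'I_3)) : phase Q S :=
  match x with
  | inl o => Simulate o
  | inr (inl (o, s, t)) => Pop o s t
  | inr (inr i) => nth Scan [:: Scan; ZeroTest; Reject] i
  end.

Lemma phase_codeK : cancel phase_code phase_decode.
Proof. by case. Qed.

HB.instance Definition _ := Finite.copy (phase Q S) (can_type phase_codeK).

End PhaseFinite.

(** The left end symbol occupies cell 0, hence the shift by one. *)
Lemma qa_scanned_letter (Sigma : finType) (w1 w2 : seq Sigma) x :
  qa_scanned (w1 ++ x :: w2) (size w1).+1 = Letter x.
Proof.
rewrite /qa_scanned /qa_tape /= map_cat rcons_cat nth_cat size_map ltnn.
by rewrite subnn.
Qed.

Lemma qa_scanned_right_end (Sigma : finType) (w : seq Sigma) :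
  qa_scanned w (size w).+1 = RightEnd.
Proof. by rewrite /qa_scanned /= nth_rcons size_map ltnn eqxx. Qed.

(** * Simulation of a Turing machine on numerals *)

Section Simulation.
Variables (Sigma : finType) (M : turing_machine Sigma).

Let phase := phase (tm_state M) (tm_symbol M).
(** Digits may reach the number of symbols, since nonblank ones start at 1. *)
Let base : nat := #|tm_symbol M|.+1.
Let b : rat := base%:R.

(* The blank is the digit 0, so that trailing blanks do not change a numeral. *)
Definition digit (s : tm_symbol M) : nat :=
  if s == tm_blank M then 0 else (enum_rank s).+1.

Definition numeral (l : seq (tm_symbol M)) : nat :=
  foldr (fun s n => digit s + n * base)%N 0%N l.

Let dig (s : tm_symbol M) : rat := (digit s)%:R.
Let num (l : seq (tm_symbol M)) : rat := (numeral l)%:R.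

Lemma digit_lt_base s : (digit s < base)%N.
Proof. by rewrite /digit; case: eqP => // _; rewrite ltnS. Qed.

Lemma digit_blank : digit (tm_blank M) = 0%N.
Proof. by rewrite /digit eqxx. Qed.

Lemma digit_inj : injective digit.
Proof.
move=> s t; rewrite /digit; case: eqP => [-> | _]; case: eqP => [-> | _] //.
by case=> /ord_inj/enum_rank_inj.
Qed.

Lemma numeral_behead l :
  numeral l = (digit (head (tm_blank M) l) + numeral (behead l) * base)%N.
Proof. by case: l => //=; rewrite digit_blank. Qed.

Lemma numeral_rcons l s :
  numeral (rcons l s) = (numeral l + base ^ size l * digit s)%N.
Proof.
elim: l => [|t l IHl] /=; first by rewrite mul0n addn0 expn0 mul1n.
by rewrite IHl expnS; lia.
Qed.

(** Compare remainders and quotients by [base]. This is why a verified guess is correct. *)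
Lemma numeral_uniq l s n : numeral l = (digit s + n * base)%N ->
  s = head (tm_blank M) l /\ n = numeral (behead l).
Proof.
rewrite numeral_behead => eq_n; have base_gt0 : (0 < base)%N by [].
split.
  apply: digit_inj; have := congr1 (modn^~ base) eq_n.
  by rewrite ![(digit _ + _)%N]addnC !modnMDl !modn_small ?digit_lt_base.
have := congr1 (divn^~ base) eq_n.
by rewrite ![(digit _ + _)%N]addnC !divnMDl // !divn_small ?digit_lt_base // !addn0.
Qed.

Let b_neq0 : b != 0.
Proof. by rewrite pnatr_eq0. Qed.

Definition pop_mx (s t : tm_symbol M) : 'M[rat]_3 :=
  affine_mx (- dig t / b) b^-1 0 (- dig s / b) 0 b^-1.

(* Besides the scanned symbol s, a move needs the symbol t to its left. *)
Definition step_mx (s t c : tm_symbol M) (m : direction) : 'M[rat]_3 :=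
  match m with
  | MoveL => affine_mx (- dig t / b) b^-1 0 (dig t + b * (dig c - dig s)) 0 b
  | MoveN => affine_mx 0 1 0 (dig c - dig s) 0 1
  | MoveR => affine_mx (dig c) b 0 (- dig s / b) 0 b^-1
  end.

Definition sim_kind (p : phase) : state_kind :=
  match p with
  | Simulate None => Existential
  | Simulate (Some q) =>
      if q == tm_accept M then Accepting
      else if q == tm_reject M then Rejecting else Existential
  | Reject => Rejecting
  | Scan | Pop _ _ _ | ZeroTest => Universal
  end.

Definition sim_succ (p : phase) : {set phase} :=
  [set p' | match p, p' with
            | Simulate o, Pop o' _ _ => o == o'
            | Simulate None, ZeroTest => true
            | _, _ => false
            end].

(* While the input is scanned, the left component holds the power b^i by which
   the next letter is weighted in the right component. *)
Definition sim_op (p : phase) (a : tape_symbol Sigma) (p' : phase) : 'M[rat]_3 :=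
  match p, p' with
  | Scan, Scan =>
      match a with
      | LeftEnd => affine_mx 1 0 0 0 0 0
      | Letter x => affine_mx 0 b 0 0 (dig (tm_letter M x)) 1
      | RightEnd => 0
      end
  | Scan, Simulate (Some q) =>
      if a is RightEnd then
        if q == tm_start M then affine_mx 0 0 0 0 0 1 else 0
      else 0
  | Pop _ s t, Simulate None => pop_mx s t
  | Pop (Some q) s t, Simulate (Some q') =>
      let: (q1, c, m) := tm_trans q s in
      if q' == q1 then step_mx s t c m else 0
  | ZeroTest, Reject => constant_kernel_mx
  | _, _ => 0
  end.

Definition sim_move (p : phase) (a : tape_symbol Sigma) : bool :=
  match p, a with
  | Scan, LeftEnd | Scan, Letter _ => true
  | _, _ => false
  end.

Lemma sim_move_right_end p : sim_move p RightEnd = false.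
Proof. by case: p. Qed.

Lemma sim_init_unit : (vec3 0 0)^T *m vec3 0 0 = 1%:M.
Proof.
by apply/matrixP => i j; rewrite !ord1 mxE sum_ord3 !mxE.
Qed.

Definition simulator : program Sigma :=
  Program sim_kind Scan sim_succ sim_op sim_move_right_end sim_init_unit.

Definition leads_to_accept (c : tm_config M) :=
  exists n, (iter n (@tm_step _ M) c).1.1 = tm_accept M.

Lemma leads_to_accept_step c : leads_to_accept (tm_step c) -> leads_to_accept c.
Proof. by case=> n acc_n; exists n.+1; rewrite iterSr. Qed.

Lemma num_behead l : num l = dig (head (tm_blank M) l) + num (behead l) * b.
Proof. by rewrite /num numeral_behead natrD natrM. Qed.

Lemma num_cons s l : num (s :: l) = dig s + num l * b.
Proof. by rewrite num_behead. Qed.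

Lemma num_rcons l s : num (rcons l s) = num l + b ^+ size l * dig s.
Proof. by rewrite /num numeral_rcons natrD natrM natrX. Qed.

Lemma num_uniq l s n : num l = dig s + n%:R * b ->
  s = head (tm_blank M) l /\ n%:R = num (behead l).
Proof.
move/eqP; rewrite -natrM -natrD eqr_nat => /eqP/numeral_uniq[-> ->].
by split.
Qed.

Lemma pop_mxE s t x y :
  pop_mx s t *m vec3 x y = vec3 ((x - dig t) / b) ((y - dig s) / b).
Proof. by rewrite affine_mxE; congr vec3; field. Qed.

Lemma pop_mx_num l r :
  pop_mx (head (tm_blank M) r) (head (tm_blank M) l) *m vec3 (num l) (num r)
  = vec3 (num (behead l)) (num (behead r)).
Proof.
by rewrite pop_mxE; congr vec3; rewrite num_behead; field.
Qed.

(** Splitting the lowest digits off both numerals leaves a field identity for each move; the digit 0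
    of the blank covers exhausted half-tapes. *)
Lemma step_mxE q l r :
    (q != tm_accept M) -> (q != tm_reject M) ->
  let: (q1, c, m) := tm_trans q (head (tm_blank M) r) in
  exists l' r', tm_step (q, l, r) = (q1, l', r') /\
    step_mx (head (tm_blank M) r) (head (tm_blank M) l) c m *m vec3 (num l) (num r)
    = vec3 (num l') (num r').
Proof.
move=> /negbTE q_acc /negbTE q_rej /=; rewrite q_acc q_rej /=.
case: (tm_trans _ _) => [[q1 c] []] /=; eexists; eexists; split; try by [].
all: rewrite affine_mxE; congr vec3; rewrite ?num_cons.
all: by rewrite ?[num l]num_behead ?[num r]num_behead; field.
Qed.

(** * Correctness of the simulation in both directions *)

Let wins (w : seq Sigma) (p : phase) := @pr_wins _ simulator w p.

(** Both half-tapes are popped in lockstep; an exhausted one keeps yielding blanks, so a common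
    length bound suffices. *)
Lemma numerals_win w n l r i : (size l <= n)%N -> (size r <= n)%N ->
  wins w (Simulate None) i (vec3 (num l) (num r)).
Proof.
elim: n l r i => [|n IHn] l r i.
  rewrite !leqn0 !size_eq0 => /eqP-> /eqP->.
  apply: (PrExistential (P := simulator) (p' := ZeroTest)) => //; first by rewrite inE.
  (* The zero test annihilates the vector, so the node wins vacuously. *)
  apply: (PrUniversal (P := simulator)) => // p'.
  case: p' => [|[]|||] /=; rewrite ?mul0mx ?eqxx //.
  by rewrite constant_kernel_mxP !eqxx.
move=> size_l size_r.
apply: (PrExistential (P := simulator)
  (p' := Pop None (head (tm_blank M) r) (head (tm_blank M) l))) => //.
  by rewrite inE.
apply: (PrUniversal (P := simulator)) => // p'.
case: p' => [|[q|]|||] /=; rewrite ?mul0mx ?eqxx // => _.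
by rewrite pop_mx_num; apply: IHn; rewrite size_behead; lia.
Qed.

Lemma configuration_wins w n q l r i :
    (iter n (@tm_step _ M) (q, l, r)).1.1 = tm_accept M ->
  wins w (Simulate (Some q)) i (vec3 (num l) (num r)).
Proof.
elim: n q l r i => [|n IHn] q l r i.
  by move=> /= ->; apply: PrAccepting; rewrite /= eqxx.
have [-> _|q_acc] := eqVneq q (tm_accept M).
  by apply: PrAccepting; rewrite /= eqxx.
have [->|q_rej] := eqVneq q (tm_reject M).
  (* A rejecting configuration is fixed by [tm_step], hence never accepts. *)
  have -> : iter n.+1 (@tm_step _ M) (tm_reject M, l, r) = (tm_reject M, l, r).
    by elim: n.+1 => //= k ->; rewrite /= eqxx orbT.
  by move=> /= /eqP; rewrite eq_sym (negbTE (tm_accept_reject M)).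
rewrite iterSr => acc_n.
apply: (PrExistential (P := simulator)
  (p' := Pop (Some q) (head (tm_blank M) r) (head (tm_blank M) l))) => //.
- by rewrite /= (negbTE q_acc) (negbTE q_rej).
- by rewrite inE.
apply: (PrUniversal (P := simulator)) => // p'.
(* Two branches matter: the numeral test, treated first, and the simulated step. *)
case: p' => [|[q'|]|||] /=; rewrite ?mul0mx ?eqxx //; last first.
  move=> _; rewrite pop_mx_num.
  by apply: (numerals_win w (n := maxn (size (behead l)) (size (behead r)))); lia.
have := step_mxE l r q_acc q_rej.
case: (tm_trans _ _) => [[q1 c] m] [l' [r' [step_c step_v]]].
case: (q' =P q1) => [-> | _]; last by rewrite mul0mx eqxx.
by rewrite step_v => _; apply: IHn; rewrite -step_c.
Qed.

Lemma scan_wins w : tm_accepts M w -> wins w Scan 0 (vec3 0 0).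
Proof.
move=> [n acc_n].
(* State of the register once the left end symbol and [w1] have been read. *)
have scan_suffix w1 w2 : w = w1 ++ w2 -> wins w Scan (size w1).+1
    (vec3 (b ^+ size w1) (num (map (@tm_letter _ M) w1))).
  elim: w2 w1 => [|x w2 IHw2] w1 def_w.
    apply: (PrUniversal (P := simulator)) => // p'.
    rewrite -[w1]cats0 -def_w qa_scanned_right_end.
    case: p' => [|[q|]|||] /=; rewrite ?mul0mx ?eqxx //.
    case: (q =P _) => [-> _ | _]; last by rewrite mul0mx eqxx.
    (* The right end resets the left component to 0, the numeral of an empty half-tape. *)
    rewrite affine_mxE !mul0r !mul1r !add0r.
    exact: (@configuration_wins w n (tm_start M) [::]).
  apply: (PrUniversal (P := simulator)) => // p'.
  have -> : qa_scanned w (size w1).+1 = Letter x by rewrite def_w qa_scanned_letter.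
  case: p' => [|[q|]|||] /=; rewrite ?mul0mx ?eqxx // => _.
  have := IHw2 (rcons w1 x); rewrite cat_rcons => /(_ def_w).
  rewrite affine_mxE size_rcons addn1 map_rcons num_rcons size_map exprS.
  by rewrite !mul0r !mul1r !add0r addr0 addrC [b ^+ _ * dig _]mulrC.
apply: (PrUniversal (P := simulator)) => // p'.
case: p' => [|[q|]|||] /=; rewrite ?mul0mx ?eqxx // => _.
rewrite affine_mxE !mul0r !addr0.
exact: (scan_suffix [::] w).
Qed.

(** The test phases take arbitrary rationals and certify them as numerals or zeros; the simulating
    phases presuppose numerals. *)
Definition wins_invariant (w : seq Sigma) (p : phase) (i : nat) (v : 'cV[rat]_3) : Prop :=
  match p with
  | Scan =>
      (i = 0%N -> v = vec3 0 0 -> tm_accepts M w) /\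
      (forall w1 w2, w = w1 ++ w2 -> i = (size w1).+1 ->
         v = vec3 (b ^+ size w1) (num (map (@tm_letter _ M) w1)) -> tm_accepts M w)
  | Simulate None => forall x y, v = vec3 x y ->
      exists l r, x = num l /\ y = num r
  | Simulate (Some q) => forall l r, v = vec3 (num l) (num r) ->
      leads_to_accept (q, l, r)
  | Pop None s t => forall x y, v = vec3 x y ->
      exists l r, x = num (t :: l) /\ y = num (s :: r)
  | Pop (Some q) s t => forall l r, v = vec3 (num l) (num r) ->
      q != tm_accept M -> q != tm_reject M -> leads_to_accept (q, l, r)
  | ZeroTest => forall x y, v = vec3 x y -> x = 0 /\ y = 0
  | Reject => False
  end.

Lemma wins_invariantP w p i v : wins w p i v -> wins_invariant w p i v.
Proof.
elim=> {p i v} [p i v | p i v p' | p i v] kind_p.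
- case: p kind_p => [|[q|]|||] //=; case: eqP => [-> _ l r _ | _]; first by exists 0%N.
  by case: eqP.
- rewrite inE => succ_p' _.
  case: p kind_p succ_p' => [|[q|]|||] //=; case: p' => [|[q'|]|o s t||] //=.
  + by case: eqVneq => // q_acc; case: eqVneq => // q_rej _ /eqP<- inv l r /inv; apply.
  + move=> _ /eqP<- inv x y /inv[l [r [-> ->]]].
    by exists (t :: l), (s :: r).
  + by move=> _ _ inv x y /inv[-> ->]; exists [::], [::].
- move=> _ inv; case: p kind_p inv => [|[q|]|o s t||] //.
  + move=> _ inv; split=> [def_i def_v | w1 [|x w2] def_w def_i def_v].
    * have := inv Scan; rewrite def_i def_v /= affine_mxE vec3_neq0 => /(_ isT)[_].
      by apply; first exact: (esym (cat0s w)); rewrite // !mul0r !addr0.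
    * have := inv (Simulate (Some (tm_start M))).
      rewrite def_i def_v -[w1]cats0 -def_w qa_scanned_right_end /= eqxx.
      rewrite affine_mxE vec3_neq0 => /(_ isT); apply.
      by rewrite !mul0r mul1r !add0r.
    * have scan_x : qa_scanned w (size w1).+1 = Letter x.
        by rewrite def_w qa_scanned_letter.
      have := inv Scan.
      rewrite def_i def_v scan_x /= affine_mxE vec3_neq0 => /(_ isT)[_].
      apply; first by rewrite def_w -cat_rcons.
        by rewrite size_rcons addn1.
      rewrite map_rcons num_rcons size_rcons size_map exprS.
      by rewrite !mul0r !mul1r !add0r addr0 addrC [dig _ * _]mulrC.
  + by rewrite /=; case: ifP => //; case: ifP.
  + move=> _ inv.
    (* The test branch always exists, so its win certifies the popped values; undoing the pop puts
       the guessed digits back. *)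
    have popP x y : v = vec3 x y -> exists l r, x = num (t :: l) /\ y = num (s :: r).
      have popE a : @pr_op _ simulator (Pop o s t) a (Simulate None) = pop_mx s t.
        by case: (o).
      move=> def_v; have := inv (Simulate None).
      rewrite def_v popE pop_mxE vec3_neq0 => /(_ isT _ _ erefl)[l [r [def_l def_r]]].
      by exists l, r; rewrite !num_cons -def_l -def_r; split; field.
    case: o inv => // q inv l r def_v q_acc q_rej.
    (* By uniqueness of digits, [t] and [s] are the symbols left of the head and under it. *)
    have [l' [r' []]] := popP _ _ def_v; rewrite !num_cons.
    move=> /num_uniq[def_t _] /num_uniq[def_s _]; subst s t.
    apply: leads_to_accept_step; have := step_mxE l r q_acc q_rej.
    have := inv (Simulate (Some (tm_trans q (head (tm_blank M) r)).1.1)).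
    rewrite def_v /=; case: (tm_trans _ _) => [[q1 c] m] /=; rewrite eqxx.
    move=> inv_q1 [l1 [r1 [-> step_v]]]; rewrite step_v vec3_neq0 in inv_q1.
    exact: inv_q1 isT _ _ erefl.
  + move=> _ inv x y def_v.
    (* A nonzero component would make the [Reject] branch exist, whose invariant is false. *)
    have := inv Reject; rewrite def_v /= constant_kernel_mxP.
    by case: (x =P 0) => [->|_ /(_ isT)//]; case: (y =P 0) => [->|_ /(_ isT)//].
Qed.

Lemma simulator_wins w : wins w Scan 0 (vec3 0 0) <-> tm_accepts M w.
Proof.
split; last exact: scan_wins.
by move/wins_invariantP => [/(_ erefl erefl)].
Qed.

End Simulation.

Theorem theorem5 (Sigma : finType) (L : seq Sigma -> Prop)
    (HL : turing_recognizable L) :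
  exists M : q1afa Sigma, q1afa_recognizes M L.
Proof.
have [M ML] := HL; exists (compiled (simulator M)) => w.
by rewrite ML compiled_accepts simulator_wins.
Qed.
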